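(* Let $\Bbbk$ be an algebraically closed field, $H$ a group, $A$ a finite dimensional associative unital $\Bbbk$-algebra, and $\phi:H\to\mathrm{Aut}(A)$, $h\mapsto\phi_h$, a group homomorphism. Let $\Phi$ be the strict categorical action of $H$ on $A\text{-mod}$ induced by $\phi$. Then there is an algebra isomorphism $$\mathcal{Z}^{\phi}(A)\;\cong\;\mathrm{End}(\Phi),$$ under which $(a,h)\in\mathcal{Z}^\phi(A)$ is identified with the natural transformation $\eta:\mathrm{Id}\Rightarrow\Phi_{h^{-1}}$ for which $\eta_M:M\to{}^{\phi_h}M$ is given by $\eta_M(v)=av$, for every $M$ in $A\text{-mod}$ and all $v\in M$.
   Context: $A\text{-mod}$ is the category of finite dimensional left $A$-modules; $\mathrm{Aut}(A)$ is the group of $\Bbbk$-algebra automorphisms. Extended centre: $\mathcal{Z}^\phi(A)$ is the subalgebra of $A\otimes\Bbbk H$ spanned by all $(a,f):=a\otimes f$, with $a\in A$, $f\in H$, such that $ab=\phi_f(b)a$ for all $b\in A$. For $\alpha\in\mathrm{Aut}(A)$ and an $A$-module $M$, ${}^\alpha M$ is the same vector space with $a\in A$ acting on $v$ by $\alpha(a)\cdot v$. The functor $\Phi_h$ on $A\text{-mod}$ is $M\mapsto {}^{\phi_{h^{-1}}}M$, and it preserves the underlying linear maps of morphisms; one has $\Phi_h\circ\Phi_g=\Phi_{hg}$ and $\Phi_e=\mathrm{Id}$. For a strict categorical action $\Gamma$ of $H$ on a $\Bbbk$-linear category (i.e. $\Bbbk$-linear endofunctors $\Gamma_h$ with $\Gamma_e=\mathrm{Id}$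 and $\Gamma_{h}\circ\Gamma_{k}=\Gamma_{hk}$), $\mathrm{End}(\Gamma):=\bigoplus_{h\in H}\mathrm{Nat}(\mathrm{Id},\Gamma_h)$ is an algebra with product of $\alpha\in\mathrm{Nat}(\mathrm{Id},\Gamma_h)$ and $\beta\in\mathrm{Nat}(\mathrm{Id},\Gamma_k)$ given by $\alpha\beta:=\Gamma_k(\alpha)\circ\beta\in\mathrm{Nat}(\mathrm{Id},\Gamma_{kh})$. *)

(* Defs.v *)
From HB Require Import structures.
From mathcomp Require Import all_boot all_order all_algebra falgebra.
From mathcomp Require Import finmap.
From mathcomp Require Import boolp classical_sets functions cardinality fsbigop.
Set Implicit Arguments.
Unset Strict Implicit.
Unset Printing Implicit Defensive.
Import GRing.Theory.
Local Open Scope ring_scope.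

(* Finite dimensional associative unital algebras.  Unlike the library's falgType
   this includes the zero algebra (no axiom 1 != 0). *)
Record fdAlg (k : fieldType) := FdAlg {
  fd_vect : vectType k;
  fd_one : fd_vect;
  fd_mul : fd_vect -> fd_vect -> fd_vect;
  fd_mulA : associative fd_mul;
  fd_mul1l : left_id fd_one fd_mul;
  fd_mul1r : right_id fd_one fd_mul;
  fd_mulDl : left_distributive fd_mul +%R;
  fd_mulDr : right_distributive fd_mul +%R;
  fd_scaleAl : forall c x y, c *: fd_mul x y = fd_mul (c *: x) y;
  fd_scaleAr : forall c x y, c *: fd_mul x y = fd_mul x (c *: y)
}.

Definition fd_sort (k : fieldType) (A : fdAlg k) : Type := fd_vect A.
Coercion fd_sort : fdAlg >-> Sortclass.

HB.instance Definition _ (k : fieldType) (A : fdAlg k) :=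
  Vector.on (fd_sort A).
HB.instance Definition _ (k : fieldType) (A : fdAlg k) :=
  GRing.Zmodule_isPzRing.Build (fd_sort A) (@fd_mulA k A) (@fd_mul1l k A)
    (@fd_mul1r k A) (@fd_mulDl k A) (@fd_mulDr k A).

Lemma fd_scalerAl (k : fieldType) (A : fdAlg k) (c : k) (x y : A) :
  c *: (x * y) = (c *: x) * y.
Proof. exact: fd_scaleAl. Qed.
Lemma fd_scalerAr (k : fieldType) (A : fdAlg k) (c : k) (x y : A) :
  c *: (x * y) = x * (c *: y).
Proof. exact: fd_scaleAr. Qed.

Definition fdAlg_of_falg (k : fieldType) (A : falgType k) : fdAlg k :=
  @FdAlg k A 1 *%R (@mulrA A) (@mul1r A) (@mulr1 A) (@mulrDl A) (@mulrDr A)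
    (@scalerAl k A) (@scalerAr k A).

Lemma fsbig_covering (T : Type) (idx : T) (op : Monoid.com_law idx)
    (I : choiceType) (F : I -> T) (s : seq I) :
  uniq s -> (forall i, i \notin s -> F i = idx) ->
  \big[op/idx]_(i \in [set: I]) F i = \big[op/idx]_(i <- s) F i.
Proof.
move=> us Fs; rewrite (@fsbigTE _ _ _ _ [fset i in s]%fset); last first.
  by move=> i; rewrite inE => /Fs.
by rewrite (perm_big s) //; apply: uniq_perm => // i; rewrite inE.
Qed.

(* The algebra A[H] of finite formal sums of a.h, a in A and h in H.  With
   regAlg k for A it is the group algebra kH; in general it is the tensor product
   of A and kH, the pure tensors being tens: see tensM and tens_universal. *)
Section GroupAlgebra.
Variables (k : fieldType) (H : groupType) (A : fdAlg k).

Record groupAlg := GroupAlg {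
  gcoef :> H -> A;
  gfin : exists s : seq H, forall h, h \notin s -> gcoef h = 0
}.

Lemma groupAlgP (x y : groupAlg) : x =1 y -> x = y.
Proof.
case: x y => [f pf] [g pg] /= fg; have {}fg : f = g by exact: funext.
by subst g; congr GroupAlg; apply: Prop_irrelevance.
Qed.

HB.instance Definition _ := gen_eqMixin groupAlg.
HB.instance Definition _ := gen_choiceMixin groupAlg.

Fact ga0_fin : exists s : seq H, forall h, h \notin s -> (0 : A) = 0.
Proof. by exists [::]. Qed.
Definition ga0 := GroupAlg ga0_fin.

Fact gaN_fin (x : groupAlg) :
  exists s : seq H, forall h, h \notin s -> - x h = 0.
Proof. by have [s xs] := gfin x; exists s => h /xs->; rewrite oppr0. Qed.
Definition gaN x := GroupAlg (gaN_fin x).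

Fact gaD_fin (x y : groupAlg) :
  exists s : seq H, forall h, h \notin s -> x h + y h = 0.
Proof.
have [[s xs] [t yt]] := (gfin x, gfin y); exists (s ++ t) => h.
by rewrite mem_cat negb_or => /andP[/xs-> /yt->]; rewrite addr0.
Qed.
Definition gaD x y := GroupAlg (gaD_fin x y).

Fact gaZ_fin (c : k) (x : groupAlg) :
  exists s : seq H, forall h, h \notin s -> c *: x h = 0.
Proof. by have [s xs] := gfin x; exists s => h /xs->; rewrite scaler0. Qed.
Definition gaZ c x := GroupAlg (gaZ_fin c x).

Fact gaDA : associative gaD.
Proof. by move=> x y z; apply: groupAlgP => h; exact: addrA. Qed.
Fact gaDC : commutative gaD.
Proof. by move=> x y; apply: groupAlgP => h; exact: addrC. Qed.
Fact ga0D : left_id ga0 gaD.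
Proof. by move=> x; apply: groupAlgP => h; exact: add0r. Qed.
Fact gaND : left_inverse ga0 gaN gaD.
Proof. by move=> x; apply: groupAlgP => h; exact: addNr. Qed.
HB.instance Definition _ :=
  GRing.isZmodule.Build groupAlg gaDA gaDC ga0D gaND.

Fact gaZA a b v : gaZ a (gaZ b v) = gaZ (a * b) v.
Proof. by apply: groupAlgP => h; exact: scalerA. Qed.
Fact ga1Z : left_id 1 gaZ.
Proof. by move=> x; apply: groupAlgP => h; exact: scale1r. Qed.
Fact gaZDr : right_distributive gaZ +%R.
Proof. by move=> c x y; apply: groupAlgP => h; exact: scalerDr. Qed.
Fact gaZDl v : {morph gaZ^~ v : a b / a + b}.
Proof. by move=> a b; apply: groupAlgP => h; exact: scalerDl. Qed.
HB.instance Definition _ :=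
  GRing.Zmodule_isLmodule.Build k groupAlg gaZA ga1Z gaZDr gaZDl.

Lemma gaDE (x y : groupAlg) h : (x + y) h = x h + y h. Proof. by []. Qed.
Lemma gaZE c (x : groupAlg) h : (c *: x) h = c *: x h. Proof. by []. Qed.
Lemma ga_sumE J (r : seq J) (F : J -> groupAlg) h :
  (\sum_(j <- r) F j) h = \sum_(j <- r) F j h.
Proof. by elim/big_ind2: _ => // _ x _ y <- <-. Qed.

Fact gmon_fin (h : H) (a : A) : exists s : seq H,
  forall g, g \notin s -> (if g == h then a else 0) = 0.
Proof. by exists [:: h] => g; rewrite inE; case: eqP. Qed.

Definition gmon (h : H) (a : A) : groupAlg := GroupAlg (gmon_fin h a).

Lemma gmonE h a : gmon h a h = a. Proof. by rewrite /= eqxx. Qed.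
Lemma gmon_out h a g : g \notin [:: h] -> gmon h a g = 0.
Proof. by rewrite inE /=; case: eqP. Qed.

Lemma gmonD h a b : gmon h (a + b) = gmon h a + gmon h b.
Proof. by apply: groupAlgP => g /=; case: eqP => // _; rewrite addr0. Qed.
Lemma gmonZ h c a : gmon h (c *: a) = c *: gmon h a.
Proof. by apply: groupAlgP => g /=; case: eqP => // _; rewrite scaler0. Qed.
Lemma gmon0 h : gmon h 0 = 0.
Proof. by apply: groupAlgP => g /=; case: eqP. Qed.

Lemma ga_supp (x : groupAlg) :
  exists2 s : seq H, uniq s & forall h, h \notin s -> x h = 0.
Proof.
have [s xs] := gfin x; exists (undup s); first exact: undup_uniq.
by move=> h; rewrite mem_undup => /xs.
Qed.

Lemma ga_supp2 (x y : groupAlg) : exists s, [/\ uniq s,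
  forall h, h \notin s -> x h = 0 & forall h, h \notin s -> y h = 0].
Proof.
have [s _ xs] := ga_supp x; have [t _ yt] := ga_supp y.
exists (undup (s ++ t)); split; first exact: undup_uniq.
  by move=> i; rewrite mem_undup mem_cat negb_or => /andP[/xs].
by move=> i; rewrite mem_undup mem_cat negb_or => /andP[_ /yt].
Qed.

Lemma gaE (x : groupAlg) s : uniq s -> (forall h, h \notin s -> x h = 0) ->
  x = \sum_(h <- s) gmon h (x h).
Proof.
move=> us xs; apply: groupAlgP => h; rewrite ga_sumE.
have [sh|sh] := boolP (h \in s); last first.
  rewrite xs // big_seq big1 // => g sg /=.
  by case: eqP sh => // ->; rewrite sg.
rewrite (bigD1_seq h) //= eqxx big1 ?addr0 // => g gh.
by rewrite eq_sym (negPf gh).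
Qed.

Lemma ga_ind (P : groupAlg -> Prop) : P 0 ->
  (forall x y, P x -> P y -> P (x + y)) -> (forall h a, P (gmon h a)) ->
  forall x, P x.
Proof.
move=> P0 PD Pi x; have [s us xs] := ga_supp x.
by rewrite (gaE us xs); apply: big_ind.
Qed.

Definition ga_mul (x y : groupAlg) : groupAlg :=
  \sum_(g \in [set: H]) \sum_(h \in [set: H]) gmon (g * h)%g (x g * y h).

Definition ga_one : groupAlg := gmon 1%g 1.

Lemma ga_mulE (x y : groupAlg) s t : uniq s -> uniq t ->
  (forall h, h \notin s -> x h = 0) -> (forall h, h \notin t -> y h = 0) ->
  ga_mul x y = \sum_(g <- s) \sum_(h <- t) gmon (g * h)%g (x g * y h).
Proof.
move=> us ut xs yt.
rewrite /ga_mul (@fsbig_covering _ _ _ _ _ s) //; last first.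
  move=> g /xs xg; rewrite (@fsbig_covering _ _ _ _ _ t) // ?big1 // => h _.
    by rewrite xg mul0r gmon0.
  by rewrite xg mul0r gmon0.
apply: eq_bigr => g _; apply: fsbig_covering => // h /yt ->.
by rewrite mulr0 gmon0.
Qed.

Fact ga_mulDl : left_distributive ga_mul +%R.
Proof.
move=> x y z; have [s [us xs ys]] := ga_supp2 x y.
have [t ut zt] := ga_supp z.
have xys h : h \notin s -> (x + y) h = 0.
  by move=> sh; rewrite gaDE xs // ys // addr0.
rewrite !(@ga_mulE _ _ s t) // -big_split /=.
apply: eq_bigr => g _; rewrite -big_split /=.
by apply: eq_bigr => h _; rewrite mulrDl gmonD.
Qed.

Fact ga_mulDr : right_distributive ga_mul +%R.
Proof.
move=> z x y; have [s [us xs ys]] := ga_supp2 x y.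
have [t ut zt] := ga_supp z.
have xys h : h \notin s -> (x + y) h = 0.
  by move=> sh; rewrite gaDE xs // ys // addr0.
rewrite !(@ga_mulE _ _ t s) // -big_split /=.
apply: eq_bigr => g _; rewrite -big_split /=.
by apply: eq_bigr => h _; rewrite mulrDr gmonD.
Qed.

Fact ga_scaleAl c x y : c *: ga_mul x y = ga_mul (c *: x) y.
Proof.
have [s us xs] := ga_supp x; have [t ut yt] := ga_supp y.
have zx h : h \notin s -> (c *: x) h = 0.
  by move=> sh; rewrite gaZE xs // scaler0.
rewrite !(@ga_mulE _ _ s t) // scaler_sumr.
apply: eq_bigr => g _; rewrite scaler_sumr.
by apply: eq_bigr => h _; rewrite -gmonZ fd_scalerAl.
Qed.

Fact ga_scaleAr c x y : c *: ga_mul x y = ga_mul x (c *: y).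
Proof.
have [s us xs] := ga_supp x; have [t ut yt] := ga_supp y.
have zy h : h \notin t -> (c *: y) h = 0.
  by move=> th; rewrite gaZE yt // scaler0.
rewrite !(@ga_mulE _ _ s t) // scaler_sumr.
apply: eq_bigr => g _; rewrite scaler_sumr.
by apply: eq_bigr => h _; rewrite -gmonZ fd_scalerAr.
Qed.

Fact ga_mul_gmon g h a b : ga_mul (gmon g a) (gmon h b) = gmon (g * h)%g (a * b).
Proof.
rewrite (@ga_mulE _ _ [:: g] [:: h]) //; try exact: gmon_out.
by rewrite !big_seq1 /= !eqxx.
Qed.

Let mul0l x : ga_mul 0 x = 0.
Proof. by rewrite -(scale0r (0 : groupAlg)) -ga_scaleAl !scale0r. Qed.
Let mul0r' x : ga_mul x 0 = 0.
Proof. by rewrite -(scale0r (0 : groupAlg)) -ga_scaleAr !scale0r. Qed.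

Fact ga_mulA : associative ga_mul.
Proof.
elim/ga_ind => [y z|x x' IHx IHx' y z|f a]; first by rewrite !mul0l.
  by rewrite !ga_mulDl IHx IHx'.
elim/ga_ind => [z|y y' IHy IHy' z|g b].
- by rewrite mul0r' !mul0l mul0r'.
- by rewrite ga_mulDr !ga_mulDl ga_mulDr IHy IHy'.
elim/ga_ind => [|z z' IHz IHz'|h c]; first by rewrite !mul0r'.
  by rewrite !ga_mulDr IHz IHz'.
by rewrite !ga_mul_gmon mulgA mulrA.
Qed.

Fact ga_mul1l : left_id ga_one ga_mul.
Proof.
elim/ga_ind => [|x y IHx IHy|h a]; first by rewrite mul0r'.
  by rewrite ga_mulDr IHx IHy.
by rewrite ga_mul_gmon mul1g mul1r.
Qed.

Fact ga_mul1r : right_id ga_one ga_mul.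
Proof.
elim/ga_ind => [|x y IHx IHy|h a]; first by rewrite mul0l.
  by rewrite ga_mulDl IHx IHy.
by rewrite ga_mul_gmon mulg1 mulr1.
Qed.

HB.instance Definition _ := GRing.Zmodule_isPzRing.Build groupAlg
  ga_mulA ga_mul1l ga_mul1r ga_mulDl ga_mulDr.

Lemma ga_scalerAl c (x y : groupAlg) : c *: (x * y) = (c *: x) * y.
Proof. exact: ga_scaleAl. Qed.
Lemma ga_scalerAr c (x y : groupAlg) : c *: (x * y) = x * (c *: y).
Proof. exact: ga_scaleAr. Qed.
Lemma gmonM g h a b : gmon g a * gmon h b = gmon (g * h)%g (a * b).
Proof. exact: ga_mul_gmon. Qed.

End GroupAlgebra.

Definition regAlg (k : fieldType) : fdAlg k := fdAlg_of_falg k^o.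

Section Tensor.
Variables (k : fieldType) (H : groupType) (A : fdAlg k).

Local Notation kH := (groupAlg H (regAlg k)).
Local Notation AkH := (groupAlg H A).

Definition gelt (h : H) : kH := gmon h (1 : regAlg k).

Fact tens_fin (a : A) (x : kH) :
  exists s : seq H, forall h, h \notin s -> (x h : k) *: a = 0.
Proof. by have [s xs] := gfin x; exists s => h /xs ->; rewrite scale0r. Qed.
Definition tens (a : A) (x : kH) : AkH := GroupAlg (tens_fin a x).

Lemma tens_linl (x : kH) : linear (tens^~ x).
Proof.
move=> c a b; apply: groupAlgP => h /=.
by rewrite scalerDr !scalerA mulrC.
Qed.
Lemma tens_linr (a : A) : linear (tens a).
Proof.
move=> c x y; apply: groupAlgP => h /=.
by rewrite scalerDl scalerA.
Qed.

Lemma tens_gmon a h (c : regAlg k) : tens a (gmon h c) = gmon h ((c : k) *: a).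
Proof.
by apply: groupAlgP => g /=; case: eqP => // _; rewrite scale0r.
Qed.

Lemma tens_gelt a h : tens a (gelt h) = gmon h a.
Proof. by rewrite tens_gmon scale1r. Qed.

Lemma tensDl a b x : tens (a + b) x = tens a x + tens b x.
Proof. by have := tens_linl x 1 a b; rewrite !scale1r. Qed.
Lemma tensDr a x y : tens a (x + y) = tens a x + tens a y.
Proof. by have := tens_linr a 1 x y; rewrite !scale1r. Qed.
Lemma tens0r a : tens a 0 = 0.
Proof. by apply: groupAlgP => h /=; rewrite scale0r. Qed.

Lemma geltM g h : gelt g * gelt h = gelt (g * h)%g.
Proof. by rewrite gmonM mulr1. Qed.

Lemma tensM (a b : A) (x y : kH) : tens a x * tens b y = tens (a * b) (x * y).
Proof.
elim/ga_ind: x => [|x x' IHx IHx'|g c].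
- by rewrite tens0r !mul0r tens0r.
- by rewrite tensDr !mulrDl IHx IHx' tensDr.
elim/ga_ind: y => [|y y' IHy IHy'|h d].
- by rewrite tens0r !mulr0 tens0r.
- by rewrite tensDr !mulrDr IHy IHy' tensDr.
by rewrite gmonM !tens_gmon gmonM -fd_scalerAl -fd_scalerAr scalerA.
Qed.

Section Universal.
Variables (W : lmodType k) (b : A -> kH -> W).
Hypothesis b_linl : forall x, linear (b^~ x).
Hypothesis b_linr : forall a, linear (b a).

Let lift (z : AkH) : W := \sum_(h \in [set: H]) b (z h) (gelt h).

Let b0l x : b 0 x = 0.
Proof. by have := b_linl x (-1) 0 0; rewrite scaler0 add0r scaleN1r addNr. Qed.
Let b0r a : b a 0 = 0.
Proof. by have := b_linr a (-1) 0 0; rewrite scaler0 add0r scaleN1r addNr. Qed.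

Let liftE (z : AkH) (s : seq H) :
  uniq s -> (forall h, h \notin s -> z h = 0) ->
  lift z = \sum_(h <- s) b (z h) (gelt h).
Proof. by move=> us zs; apply: fsbig_covering => // h /zs ->; rewrite b0l. Qed.

Let lift_linear : linear lift.
Proof.
move=> c x y; have [s [us xs ys]] := ga_supp2 x y.
have xys h : h \notin s -> (c *: x + y) h = 0.
  by move=> hs; rewrite gaDE gaZE xs // ys // scaler0 addr0.
rewrite !(@liftE _ s) // scaler_sumr -big_split /=.
by apply: eq_bigr => h _; rewrite b_linl.
Qed.

Let lift_gmon h (a : A) : lift (gmon h a) = b a (gelt h).
Proof.
rewrite (@liftE _ [:: h]) //; last exact: gmon_out.
by rewrite big_seq1 /= eqxx.
Qed.

Lemma tens_universal : exists g : {linear AkH -> W},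
  (forall a x, g (tens a x) = b a x) /\
  forall g' : {linear AkH -> W}, (forall a x, g' (tens a x) = b a x) -> g' =1 g.
Proof.
pose lm := GRing.isLinear.Build k AkH W *:%R lift lift_linear.
pose g : {linear AkH -> W} := HB.pack lift lm.
exists g; split=> [a x|g' g'b z].
  elim/ga_ind: x => [|x y IHx IHy|h c].
  - by rewrite tens0r linear0 b0r.
  - by rewrite tensDr linearD IHx IHy; have := b_linr a 1 x y; rewrite !scale1r.
  rewrite tens_gmon [LHS]lift_gmon.
  have := b_linl (gelt h) c a 0; rewrite b0l !addr0 => ->.
  have := b_linr a c (gelt h) 0; rewrite b0r !addr0 => <-.
  by rewrite /gelt -gmonZ [_ *: _]mulr1.
elim/ga_ind: z => [|x y IHx IHy|h a]; first by rewrite !linear0.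
  by rewrite !linearD IHx IHy.
by have := g'b a (gelt h); rewrite tens_gelt => ->; rewrite [RHS]lift_gmon.
Qed.

End Universal.

End Tensor.

Section Automorphisms.
Variables (k : fieldType) (A : fdAlg k).

Definition is_aut (f : A -> A) : Prop :=
  [/\ linear f, f 1 = 1, {morph f : a b / a * b} & bijective f].

Record algAut := AlgAut { aut_fun :> A -> A; autP : is_aut aut_fun }.

Lemma algAut_ext (f g : algAut) : f =1 g -> f = g.
Proof.
case: f g => [f pf] [g pg] /= fg; have {}fg : f = g by exact: funext.
by subst g; congr AlgAut; apply: Prop_irrelevance.
Qed.

HB.instance Definition _ := gen_eqMixin algAut.
HB.instance Definition _ := gen_choiceMixin algAut.

Fact aut_id : is_aut id.
Proof. by split=> //; exists id. Qed.

Fact aut_comp (f g : algAut) : is_aut (f \o g).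
Proof.
have [[fl f1 fM fb] [gl g1 gM gb]] := (autP f, autP g); split=> /=.
- by move=> c a b /=; rewrite gl fl.
- by rewrite g1.
- by move=> a b /=; rewrite gM fM.
- exact: bij_comp.
Qed.

Fact aut_inv_ex (f : algAut) : exists g : algAut, cancel f g /\ cancel g f.
Proof.
have [fl f1 fM [g fK gK]] := autP f.
suff gP : is_aut g by exists (AlgAut gP).
split; last by exists f.
- by move=> c a b; apply: (can_inj fK); rewrite fl !gK.
- by rewrite -f1 fK.
- by move=> a b; apply: (can_inj fK); rewrite fM !gK.
Qed.

Definition aut_one := AlgAut aut_id.
Definition aut_mul (f g : algAut) := AlgAut (aut_comp f g).
Definition aut_inv (f : algAut) : algAut := projT1 (cid (aut_inv_ex f)).

Fact aut_mulA : associative aut_mul.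
Proof. by move=> f g h; apply: algAut_ext. Qed.
Fact aut_mul1 : left_id aut_one aut_mul.
Proof. by move=> f; apply: algAut_ext. Qed.
Fact aut_1mul : right_id aut_one aut_mul.
Proof. by move=> f; apply: algAut_ext. Qed.
Fact aut_mulV : left_inverse aut_one aut_inv aut_mul.
Proof.
move=> f; apply: algAut_ext => a /=; rewrite /aut_inv.
by case: cid => g /= [].
Qed.
Fact aut_Vmul : right_inverse aut_one aut_inv aut_mul.
Proof.
move=> f; apply: algAut_ext => a /=; rewrite /aut_inv.
by case: cid => g /= [].
Qed.
HB.instance Definition _ :=
  isGroup.Build algAut aut_mulA aut_mul1 aut_1mul aut_mulV aut_Vmul.

End Automorphisms.

Section ExtendedCentre.
Variables (k : fieldType) (H : groupType) (A : fdAlg k).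
Variable phi : {multiplicative H -> algAut A}.

Definition ext_central (a : A) (f : H) : Prop :=
  forall b : A, a * b = phi f b * a.

Definition ext_span (x : groupAlg H A) : Prop :=
  exists (n : nat) (c : 'I_n -> k) (a : 'I_n -> A) (f : 'I_n -> H),
    (forall i, ext_central (a i) (f i)) /\
    x = \sum_(i < n) c i *: tens (a i) (gelt k (f i)).

Definition extZ : {pred groupAlg H A} := [pred x | `[< ext_span x >]].

Lemma ext_span0 : ext_span 0.
Proof.
exists 0%N, (fun=> 0), (fun=> 0), (fun=> 1%g).
by split=> [[]//|]; rewrite big_ord0.
Qed.

Lemma ext_spanD x y : ext_span x -> ext_span y -> ext_span (x + y).
Proof.
move=> [n [c [a [f [cx ->]]]]] [m [d [b [g [dy ->]]]]].
pose glue T (u : 'I_n -> T) (v : 'I_m -> T) (i : 'I_(n + m)) :=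
  match fintype.split i with inl j => u j | inr l => v l end.
have gl T u v j : glue T u v (lshift m j) = u j.
  by rewrite /glue (unsplitK (inl _ j)).
have gr T u v j : glue T u v (rshift n j) = v j.
  by rewrite /glue (unsplitK (inr _ j)).
exists (n + m)%N, (glue _ c d), (glue _ a b), (glue _ f g); split.
  by move=> i; rewrite /glue; case: fintype.split.
rewrite big_split_ord /=; congr (_ + _); apply: eq_bigr => i _.
  by rewrite !gl.
by rewrite !gr.
Qed.

Lemma ext_spanZ e x : ext_span x -> ext_span (e *: x).
Proof.
move=> [n [c [a [f [cx ->]]]]]; exists n, (fun i => e * c i), a, f; split=> //.
by rewrite scaler_sumr; apply: eq_bigr => i _; rewrite scalerA.
Qed.

Lemma ext_span_gen a f : ext_central a f -> ext_span (tens a (gelt k f)).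
Proof.
move=> af; exists 1%N, (fun=> 1), (fun=> a), (fun=> f); split=> //.
by rewrite big_ord1 scale1r.
Qed.

Lemma ext_centralM a b f g :
  ext_central a f -> ext_central b g -> ext_central (a * b) (f * g)%g.
Proof.
move=> af bg c; rewrite -mulrA bg mulrA af -mulrA; congr (_ * _).
by rewrite gmulfM.
Qed.

Lemma ext_central1 : ext_central 1 1%g.
Proof.
move=> b; rewrite mul1r mulr1; have -> : phi 1%g = 1%g; last by [].
by apply: (mulgI (phi 1%g)); rewrite -gmulfM !mulg1.
Qed.

Lemma ext_span1 : ext_span 1.
Proof.
have -> : 1 = tens 1 (gelt k 1%g) :> groupAlg H A by rewrite tens_gelt.
exact/ext_span_gen/ext_central1.
Qed.

Lemma ext_span_sum n (F : 'I_n -> groupAlg H A) :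
  (forall i, ext_span (F i)) -> ext_span (\sum_(i < n) F i).
Proof.
move=> FP; apply: big_ind => //; [exact: ext_span0 | exact: ext_spanD].
Qed.

Lemma ext_spanM x y : ext_span x -> ext_span y -> ext_span (x * y).
Proof.
move=> [n [c [a [f [cx ->]]]]] [m [d [b [g [dy ->]]]]].
rewrite mulr_suml; apply: ext_span_sum => i.
rewrite mulr_sumr; apply: ext_span_sum => j.
rewrite -ga_scalerAl -ga_scalerAr; do 2!apply: ext_spanZ.
rewrite tensM geltM; exact/ext_span_gen/ext_centralM.
Qed.

Lemma extZP x : reflect (ext_span x) (x \in extZ).
Proof. exact: asboolP. Qed.

Fact extZ_submod : submod_closed extZ.
Proof.
split=> [|c x y]; first exact/extZP/ext_span0.
move=> /extZP xP /extZP yP; apply/extZP/ext_spanD => //.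
exact: ext_spanZ.
Qed.
Fact extZ_subring : subring_closed extZ.
Proof.
split=> [|x y|x y]; first exact/extZP/ext_span1.
- move=> /extZP xP /extZP yP; apply/extZP/ext_spanD => //.
  by rewrite -scaleN1r; exact: ext_spanZ.
- by move=> /extZP xP /extZP yP; apply/extZP/ext_spanM.
Qed.
HB.instance Definition _ := GRing.isSubringClosed.Build _ extZ extZ_subring.
HB.instance Definition _ := GRing.isSubmodClosed.Build k _ extZ extZ_submod.

Record extCentre := ExtCentre {
  ext_val :> groupAlg H A;
  _ : ext_val \in extZ
}.

HB.instance Definition _ := [isSub for ext_val].
HB.instance Definition _ := [Choice of extCentre by <:].
HB.instance Definition _ :=
  GRing.SubChoice_isSubPzRing.Build _ _ extCentre (subringClosedP _).
HB.instance Definition _ := [SubZmodule_isSubLmodule of extCentre by <:].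

End ExtendedCentre.

Record klincat (k : fieldType) := KLinCat {
  ob :> Type;
  hom : ob -> ob -> lmodType k;
  idm : forall x, hom x x;
  comp : forall x y z, hom y z -> hom x y -> hom x z;
  comp1m : forall x y (f : hom x y), comp (idm y) f = f;
  compm1 : forall x y (f : hom x y), comp f (idm x) = f;
  compA : forall x y z t (h : hom z t) (g : hom y z) (f : hom x y),
    comp h (comp g f) = comp (comp h g) f;
  comp_linl : forall x y z (f : hom x y), linear (fun g : hom y z => comp g f);
  comp_linr : forall x y z (g : hom y z), linear (fun f : hom x y => comp g f)
}.

Section Functors.
Variables (k : fieldType) (C : klincat k).

Definition is_functor (F : C -> C)
    (Fm : forall x y : C, hom x y -> hom (F x) (F y)) : Prop :=
  [/\ forall x y, linear (Fm x y), forall x, Fm x x (idm x) = idm (F x) &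
    forall x y z (g : hom y z) (f : hom x y),
      Fm x z (comp g f) = comp (Fm y z g) (Fm x y f)].

Record endofunctor := Endofunctor {
  fob :> C -> C;
  fmap : forall x y : C, hom x y -> hom (fob x) (fob y);
  functorP : is_functor fmap
}.

Lemma endofunctor_ext F (m m' : forall x y : C, hom x y -> hom (F x) (F y))
    (p : is_functor m) (p' : is_functor m') :
  (forall x y f, m x y f = m' x y f) -> Endofunctor p = Endofunctor p'.
Proof.
move=> mm'; have e : m = m'.
  apply: functional_extensionality_dep => x.
  by apply: functional_extensionality_dep => y; exact: funext.
by subst m'; congr Endofunctor; exact: Prop_irrelevance.
Qed.

Fact idF_subproof : @is_functor id (fun x y f => f).
Proof. by split. Qed.
Definition idF := Endofunctor idF_subproof.

Fact compF_subproof (G F : endofunctor) :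
  @is_functor (G \o F) (fun x y f => fmap G (fmap F f)).
Proof.
have [[Gl G1 GM] [Fl F1 FM]] := (functorP G, functorP F); split=> /=.
- by move=> x y c f g; rewrite Fl Gl.
- by move=> x; rewrite F1 G1.
- by move=> x y z g f; rewrite FM GM.
Qed.
Definition compF G F := Endofunctor (compF_subproof G F).

Section Nat.
Variables F G : endofunctor.

Definition is_natural (t : forall x, hom (F x) (G x)) : Prop :=
  forall x y (f : hom x y), comp (t y) (fmap F f) = comp (fmap G f) (t x).

Record nattrans := NatTrans {
  ncomp :> forall x, hom (F x) (G x);
  naturalP : is_natural ncomp
}.

Lemma nattrans_ext (s t : nattrans) : (forall x, s x = t x) -> s = t.
Proof.
case: s t => [s ps] [t pt] /= st.
have {}st : s = t by exact: functional_extensionality_dep.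
by subst s; congr NatTrans; exact: Prop_irrelevance.
Qed.

Fact nat_lin_subproof (c : k) (s t : nattrans) :
  is_natural (fun x => c *: s x + t x).
Proof.
by move=> x y f; rewrite comp_linl comp_linr !naturalP.
Qed.
Fact nat0_subproof : is_natural (fun x => 0).
Proof.
move=> x y f; have := comp_linl (fmap F f) (-1) (0 : hom (F y) (G y)) 0.
have := comp_linr (fmap G f) (-1) (0 : hom (F x) (G x)) 0.
by rewrite !scaler0 !addr0 !scaleN1r !addNr => -> ->.
Qed.
Definition nat0 := NatTrans nat0_subproof.

Fact natD_subproof (s t : nattrans) : is_natural (fun x => s x + t x).
Proof.
by move=> x y f; have := nat_lin_subproof 1 s t f; rewrite /= !scale1r.
Qed.
Definition natD s t := NatTrans (natD_subproof s t).

Fact natZ_subproof c (s : nattrans) : is_natural (fun x => c *: s x).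
Proof.
by move=> x y f; have := nat_lin_subproof c s nat0 f; rewrite /= !addr0.
Qed.
Definition natZ c s := NatTrans (natZ_subproof c s).

Definition natN s := natZ (-1) s.

Fact natDA : associative natD.
Proof. by move=> s t u; apply: nattrans_ext => x; exact: addrA. Qed.
Fact natDC : commutative natD.
Proof. by move=> s t; apply: nattrans_ext => x; exact: addrC. Qed.
Fact nat0D : left_id nat0 natD.
Proof. by move=> s; apply: nattrans_ext => x; exact: add0r. Qed.
Fact natND : left_inverse nat0 natN natD.
Proof.
by move=> s; apply: nattrans_ext => x /=; rewrite scaleN1r addNr.
Qed.
Fact natZA a b v : natZ a (natZ b v) = natZ (a * b) v.
Proof. by apply: nattrans_ext => x; exact: scalerA. Qed.
Fact nat1Z : left_id 1 natZ.
Proof. by move=> s; apply: nattrans_ext => x; exact: scale1r. Qed.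
Fact natZDr c s t : natZ c (natD s t) = natD (natZ c s) (natZ c t).
Proof. by apply: nattrans_ext => x; exact: scalerDr. Qed.
Fact natZDl v a b : natZ (a + b) v = natD (natZ a v) (natZ b v).
Proof. by apply: nattrans_ext => x; exact: scalerDl. Qed.

Lemma natD0 : right_id nat0 natD.
Proof. by move=> s; rewrite natDC nat0D. Qed.

HB.instance Definition _ :=
  Monoid.isComLaw.Build nattrans nat0 natD natDA natDC nat0D.

Lemma natZ0 c : natZ c nat0 = nat0.
Proof. by apply: nattrans_ext => x /=; rewrite scaler0. Qed.

End Nat.

Fact idN_subproof : @is_natural idF idF (fun x => idm x).
Proof. by move=> x y f; rewrite comp1m compm1. Qed.
Definition idN : nattrans idF idF := NatTrans idN_subproof.

Fact whiskN_subproof (G K : endofunctor)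
    (s : nattrans idF G) (t : nattrans idF K) :
  @is_natural idF (compF K G) (fun x => comp (fmap K (s x)) (t x)).
Proof.
move=> x y f /=; have [_ _ KM] := functorP K.
have /= ns := naturalP s f; have /= nt := naturalP t f.
by rewrite -compA nt compA -KM ns KM compA.
Qed.
Definition whiskN G K (s : nattrans idF G) (t : nattrans idF K) :
  nattrans idF (compF K G) := NatTrans (whiskN_subproof s t).

End Functors.

Arguments idF {k C}.
Arguments idN {k C}.

Record strictAction (k : fieldType) (H : groupType) (C : klincat k) :=
  StrictAction {
    sact :> H -> endofunctor C;
    sact1 : sact 1%g = idF;
    sactM : forall h g, sact (h * g)%g = compF (sact h) (sact g)
  }.

(* k-algebras whose carrier need not lie in the universe of the carriers of the
   library's structures.  End(Gamma) needs this: a natural transformation is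
   indexed by all objects of a category that may be large. *)
Record kalg (k : fieldType) := KAlg {
  kcar :> Type;
  kzero : kcar;
  kadd : kcar -> kcar -> kcar;
  kopp : kcar -> kcar;
  kscale : k -> kcar -> kcar;
  kone : kcar;
  kmul : kcar -> kcar -> kcar;
  kaddA : associative kadd;
  kaddC : commutative kadd;
  kadd0 : left_id kzero kadd;
  kaddN : left_inverse kzero kopp kadd;
  kscaleA : forall a b x, kscale a (kscale b x) = kscale (a * b) x;
  kscale1 : left_id 1 kscale;
  kscaleDr : forall a x y, kscale a (kadd x y) = kadd (kscale a x) (kscale a y);
  kscaleDl : forall a b x, kscale (a + b) x = kadd (kscale a x) (kscale b x);
  kmulA : associative kmul;
  kmul1l : left_id kone kmul;
  kmul1r : right_id kone kmul;
  kmulDl : left_distributive kmul kadd;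
  kmulDr : right_distributive kmul kadd;
  kscaleAl : forall c x y, kscale c (kmul x y) = kmul (kscale c x) y;
  kscaleAr : forall c x y, kscale c (kmul x y) = kmul x (kscale c y)
}.

Record algIso (k : fieldType) (B C : kalg k) := AlgIso {
  iso_fun :> B -> C;
  isoD : forall x y, iso_fun (kadd x y) = kadd (iso_fun x) (iso_fun y);
  isoZ : forall c x, iso_fun (kscale c x) = kscale c (iso_fun x);
  iso1 : iso_fun (kone B) = kone C;
  isoM : forall x y, iso_fun (kmul x y) = kmul (iso_fun x) (iso_fun y);
  iso_bij : bijective iso_fun
}.

Section ExtCentreAlg.
Variables (k : fieldType) (H : groupType) (A : fdAlg k).
Variable phi : {multiplicative H -> algAut A}.

Fact ext_scaleAl c (x y : extCentre phi) : c *: (x * y) = (c *: x) * y.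
Proof. by apply: val_inj; exact: ga_scalerAl. Qed.
Fact ext_scaleAr c (x y : extCentre phi) : c *: (x * y) = x * (c *: y).
Proof. by apply: val_inj; exact: ga_scalerAr. Qed.

Definition extCentreAlg : kalg k :=
  @KAlg k (extCentre phi) 0 +%R -%R *:%R 1 *%R
    (@addrA _) (@addrC _) (@add0r _) (@addNr _)
    (@scalerA _ _) (@scale1r _ _) (@scalerDr _ _)
    (fun a b x => scalerDl x a b)
    (@mulrA _) (@mul1r _) (@mulr1 _) (@mulrDl _) (@mulrDr _)
    ext_scaleAl ext_scaleAr.

End ExtCentreAlg.

Lemma big_covering (T : Type) (idx : T) (op : Monoid.com_law idx)
    (I : eqType) (F : I -> T) (s t : seq I) : uniq s -> uniq t ->
  (forall i, i \notin s -> F i = idx) -> (forall i, i \notin t -> F i = idx) ->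
  \big[op/idx]_(i <- s) F i = \big[op/idx]_(i <- t) F i.
Proof.
move=> us ut Fs Ft.
rewrite (bigID (mem t)) /= [X in op _ X]big1 ?Monoid.mulm1 //.
rewrite [RHS](bigID (mem s)) /= [X in op _ X]big1 ?Monoid.mulm1 //.
rewrite -[LHS]big_filter -[RHS]big_filter; apply: perm_big.
by apply: uniq_perm => [||i]; rewrite ?filter_uniq // !mem_filter andbC.
Qed.

Section EndAction.
Variables (k : fieldType) (H : groupType) (C : klincat k).
Variable Gam : strictAction H C.

Definition natcast (F G : endofunctor C) (e : F = G) (t : nattrans idF F) :
  nattrans idF G := ecast G (nattrans idF G) e t.

Definition hone : nattrans idF (Gam 1%g) := natcast (esym (sact1 Gam)) idN.

(* The product Gam_g(s) o t, in Nat(Id, Gam_g o Gam_h) = Nat(Id, Gam_(gh)). *)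
Definition hmul (h g : H)
    (s : nattrans idF (Gam h)) (t : nattrans idF (Gam g)) :
  nattrans idF (Gam (g * h)%g) :=
  natcast (esym (sactM Gam g h)) (whiskN s t).

Lemma natcast_lin F G (e : F = G) c s t :
  natcast e (natD (natZ c s) t) = natD (natZ c (natcast e s)) (natcast e t).
Proof. by case: G / e. Qed.

Lemma hmul_linl (h g : H) c (s s' : nattrans idF (Gam h))
    (t : nattrans idF (Gam g)) :
  hmul (natD (natZ c s) s') t = natD (natZ c (hmul s t)) (hmul s' t).
Proof.
rewrite /hmul -natcast_lin; congr natcast.
have [Fl _ _] := functorP (Gam g).
by apply: nattrans_ext => x /=; rewrite Fl comp_linl.
Qed.

Lemma hmul_linr (h g : H) c (s : nattrans idF (Gam h))
    (t t' : nattrans idF (Gam g)) :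
  hmul s (natD (natZ c t) t') = natD (natZ c (hmul s t)) (hmul s t').
Proof.
rewrite /hmul -natcast_lin; congr natcast.
by apply: nattrans_ext => x /=; rewrite comp_linr.
Qed.

Lemma hmulDl h g (s s' : nattrans idF (Gam h)) (t : nattrans idF (Gam g)) :
  hmul (natD s s') t = natD (hmul s t) (hmul s' t).
Proof. by have := hmul_linl 1 s s' t; rewrite !nat1Z. Qed.
Lemma hmulDr h g (s : nattrans idF (Gam h)) (t t' : nattrans idF (Gam g)) :
  hmul s (natD t t') = natD (hmul s t) (hmul s t').
Proof. by have := hmul_linr 1 s t t'; rewrite !nat1Z. Qed.
Lemma hmul0l h g (t : nattrans idF (Gam g)) :
  hmul (nat0 idF (Gam h)) t = nat0 _ _.
Proof.
have := hmul_linl (-1) (nat0 idF (Gam h)) (nat0 _ _) t.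
by rewrite natZ0 nat0D => ->; exact: natND.
Qed.
Lemma hmul0r h g (s : nattrans idF (Gam h)) :
  hmul s (nat0 idF (Gam g)) = nat0 _ _.
Proof.
have := hmul_linr (-1) s (nat0 idF (Gam g)) (nat0 _ _).
by rewrite natZ0 nat0D => ->; exact: natND.
Qed.
Lemma hmulZl h g c (s : nattrans idF (Gam h)) (t : nattrans idF (Gam g)) :
  hmul (natZ c s) t = natZ c (hmul s t).
Proof.
have := hmul_linl c s (nat0 _ _) t.
by rewrite hmul0l !natD0.
Qed.
Lemma hmulZr h g c (s : nattrans idF (Gam h)) (t : nattrans idF (Gam g)) :
  hmul s (natZ c t) = natZ c (hmul s t).
Proof.
have := hmul_linr c s t (nat0 _ _).
by rewrite hmul0r !natD0.
Qed.

Let E (F : endofunctor C) : Type := nattrans idF F.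

Let natcastE F G (e : F = G) (t : E F) : existT E G (natcast e t) = existT E F t.
Proof. by case: G / e. Qed.

Let existT_E F (m m' : forall x y : C, hom x y -> hom (F x) (F y)) p p'
    (u : E (@Endofunctor k C F m p)) (v : E (@Endofunctor k C F m' p')) :
  (forall x y f, m x y f = m' x y f) ->
  (forall x, ncomp u x = ncomp v x) -> existT E _ u = existT E _ v.
Proof.
move=> mm' uv; have e : m = m'.
  apply: functional_extensionality_dep => x.
  by apply: functional_extensionality_dep => y; exact: funext.
subst m'; have e := Prop_irrelevance p p'; subst p'.
by congr existT; exact: nattrans_ext.
Qed.

Let gsp_end (h : H) : Type := nattrans idF (Gam h).

Let Tagged_end h g (u : gsp_end h) (v : gsp_end g) : h = g ->
  existT E (Gam h) u = existT E (Gam g) v -> existT gsp_end _ u = existT gsp_end _ v.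
Proof.
move=> hg; subst g => e; congr existT; move: (projT2_eq e).
by rewrite (Prop_irrelevance (projT1_eq e) erefl).
Qed.

Let smul (p q : {F : endofunctor C & E F}) : {F : endofunctor C & E F} :=
  existT E (compF (projT1 q) (projT1 p)) (whiskN (projT2 p) (projT2 q)).

Let hmulE h g (s : gsp_end h) (t : gsp_end g) :
  existT E _ (hmul s t) = smul (existT E _ s) (existT E _ t).
Proof. exact: natcastE. Qed.

Let honeE : existT E _ hone = existT E _ idN.
Proof. exact: natcastE. Qed.

Let smulA : associative smul.
Proof.
move=> [F s] [G t] [K u]; apply: existT_E => //= x.
by have [_ _ KM] := functorP K; rewrite KM compA.
Qed.

Let smul1l : left_id (existT E idF idN) smul.
Proof.
move=> [[F m p] s]; apply: existT_E => //= x.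
by have [_ -> _] := p; rewrite comp1m.
Qed.

Let smul1r : right_id (existT E idF idN) smul.
Proof. by move=> [[F m p] s]; apply: existT_E => //= x; rewrite compm1. Qed.

Fact hmulA (h g l : H) (s : gsp_end h) (t : gsp_end g) (u : gsp_end l) :
  existT gsp_end _ (hmul s (hmul t u))
    = existT gsp_end _ (hmul (hmul s t) u).
Proof.
by apply: Tagged_end; [rewrite mulgA | rewrite !hmulE smulA].
Qed.

Fact hmul1l (h : H) (s : gsp_end h) :
  existT gsp_end _ (hmul hone s) = existT gsp_end _ s.
Proof.
by apply: Tagged_end; [rewrite mulg1 | rewrite hmulE honeE smul1l].
Qed.

Fact hmul1r (h : H) (s : gsp_end h) :
  existT gsp_end _ (hmul s hone) = existT gsp_end _ s.
Proof.
by apply: Tagged_end; [rewrite mul1g | rewrite hmulE honeE smul1r].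
Qed.

Record endT := EndT {
  ecomp :> forall h : H, nattrans idF (Gam h);
  efin : exists s : seq H, forall h, h \notin s -> ecomp h = nat0 _ _
}.

Lemma endP (x y : endT) : (forall h, x h = y h) -> x = y.
Proof.
case: x y => [f pf] [g pg] /= fg.
have {}fg : f = g by exact: functional_extensionality_dep.
by subst g; congr EndT; apply: Prop_irrelevance.
Qed.

Fact end0_fin : exists s : seq H, forall h, h \notin s ->
  nat0 idF (Gam h) = nat0 _ _.
Proof. by exists [::]. Qed.
Definition end0 := EndT end0_fin.

Fact endD_fin (x y : endT) :
  exists s : seq H, forall h, h \notin s -> natD (x h) (y h) = nat0 _ _.
Proof.
have [[s xs] [t yt]] := (efin x, efin y); exists (s ++ t) => h.
by rewrite mem_cat negb_or => /andP[/xs-> /yt->]; rewrite nat0D.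
Qed.
Definition endD x y := EndT (endD_fin x y).

Fact endZ_fin (c : k) (x : endT) :
  exists s : seq H, forall h, h \notin s -> natZ c (x h) = nat0 _ _.
Proof. by have [s xs] := efin x; exists s => h /xs->; rewrite natZ0. Qed.
Definition endZ c x := EndT (endZ_fin c x).
Definition endN x := endZ (-1) x.

Fact endDA : associative endD.
Proof. by move=> x y z; apply: endP => h; exact: natDA. Qed.
Fact endDC : commutative endD.
Proof. by move=> x y; apply: endP => h; exact: natDC. Qed.
Fact end0D : left_id end0 endD.
Proof. by move=> x; apply: endP => h; exact: nat0D. Qed.
Fact endND : left_inverse end0 endN endD.
Proof. by move=> x; apply: endP => h; exact: natND. Qed.
HB.instance Definition _ := Monoid.isComLaw.Build endT end0 endD endDA endDC end0D.

Fact endZA a b v : endZ a (endZ b v) = endZ (a * b) v.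
Proof. by apply: endP => h; exact: natZA. Qed.
Fact end1Z : left_id 1 endZ.
Proof. by move=> x; apply: endP => h; exact: nat1Z. Qed.
Fact endZDr c x y : endZ c (endD x y) = endD (endZ c x) (endZ c y).
Proof. by apply: endP => h; exact: natZDr. Qed.
Fact endZDl a b v : endZ (a + b) v = endD (endZ a v) (endZ b v).
Proof. by apply: endP => h; exact: natZDl. Qed.
Lemma endZ0 c : endZ c end0 = end0.
Proof. by apply: endP => h; exact: natZ0. Qed.

Definition einj_fun h (s : nattrans idF (Gam h)) g : nattrans idF (Gam g) :=
  if @eqP H h g is ReflectT e then ecast g (nattrans idF (Gam g)) e s
  else nat0 _ _.

Lemma einj_funE h (s : nattrans idF (Gam h)) : einj_fun s h = s.
Proof.
rewrite /einj_fun; case: eqP => // e.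
by rewrite (Prop_irrelevance e erefl).
Qed.

Lemma einj_out h (s : nattrans idF (Gam h)) g :
  g \notin [:: h] -> einj_fun s g = nat0 _ _.
Proof. by rewrite inE eq_sym /einj_fun; case: eqP. Qed.

Fact einj_fin h (s : nattrans idF (Gam h)) :
  exists r : seq H, forall g, g \notin r -> einj_fun s g = nat0 _ _.
Proof. by exists [:: h] => g; exact: einj_out. Qed.
Definition einj h (s : nattrans idF (Gam h)) : endT := EndT (einj_fin s).

Lemma einjD h (s t : nattrans idF (Gam h)) :
  einj (natD s t) = endD (einj s) (einj t).
Proof.
apply: endP => g; rewrite /= /einj_fun; case: eqP => [e|_].
  by case: g / e.
by rewrite nat0D.
Qed.

Lemma einjZ h c (s : nattrans idF (Gam h)) : einj (natZ c s) = endZ c (einj s).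
Proof.
apply: endP => g; rewrite /= /einj_fun; case: eqP => [e|_].
  by case: g / e.
by rewrite natZ0.
Qed.

Lemma einj0 h : einj (nat0 idF (Gam h)) = end0.
Proof.
apply: endP => g; rewrite /= /einj_fun; case: eqP => [e|//].
by case: g / e.
Qed.

Lemma einj_existT h g (s : gsp_end h) (t : gsp_end g) :
  existT gsp_end _ s = existT gsp_end _ t -> einj s = einj t.
Proof. by move/(congr1 (fun p => einj (projT2 p))). Qed.

Lemma end_supp (x : endT) :
  exists2 s : seq H, uniq s & forall h, h \notin s -> x h = nat0 _ _.
Proof.
have [s xs] := efin x; exists (undup s); first exact: undup_uniq.
by move=> h; rewrite mem_undup => /xs.
Qed.

Lemma end_supp2 (x y : endT) : exists s, [/\ uniq s,
  forall h, h \notin s -> x h = nat0 _ _ &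
  forall h, h \notin s -> y h = nat0 _ _].
Proof.
have [s _ xs] := end_supp x; have [t _ yt] := end_supp y.
exists (undup (s ++ t)); split; first exact: undup_uniq.
  by move=> i; rewrite mem_undup mem_cat negb_or => /andP[/xs].
by move=> i; rewrite mem_undup mem_cat negb_or => /andP[_ /yt].
Qed.

Lemma endE (x : endT) s : uniq s -> (forall h, h \notin s -> x h = nat0 _ _) ->
  x = \big[endD/end0]_(h <- s) einj (x h).
Proof.
move=> us xs; apply: endP => h.
have ev0 : end0 h = nat0 _ _ by [].
have evD : {morph (fun y : endT => y h) : y z / endD y z >-> natD y z} by [].
rewrite (big_morph (fun y : endT => y h) evD ev0).
have [sh|sh] := boolP (h \in s); last first.
  rewrite xs // big1_seq // => g /andP[_ sg]; apply: einj_out.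
  by rewrite inE; apply: contraNneq sh => ->.
rewrite (bigD1_seq h) //= einj_funE big1 ?natD0 // => g gh.
by apply: einj_out; rewrite inE eq_sym.
Qed.

Lemma end_ind (P : endT -> Prop) : P end0 ->
  (forall x y, P x -> P y -> P (endD x y)) ->
  (forall h (s : nattrans idF (Gam h)), P (einj s)) -> forall x, P x.
Proof.
move=> P0 PD Pi x; have [s us xs] := end_supp x.
by rewrite (endE us xs); apply: big_ind.
Qed.

Definition esupp (x : endT) : seq H := undup (projT1 (cid (efin x))).

Lemma esupp_out (x : endT) h : h \notin esupp x -> x h = nat0 _ _.
Proof. by rewrite /esupp mem_undup; case: cid => s /= xs /xs. Qed.

(* The bilinear extension of hmul; esupp x lists, without repetition, degrees
   outside of which x vanishes. *)
Definition end_mul (x y : endT) : endT :=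
  \big[endD/end0]_(h <- esupp x) \big[endD/end0]_(g <- esupp y)
    einj (hmul (x h) (y g)).

Definition end_one : endT := einj hone.

Lemma end_mulE (x y : endT) s t : uniq s -> uniq t ->
  (forall h, h \notin s -> x h = nat0 _ _) ->
  (forall h, h \notin t -> y h = nat0 _ _) ->
  end_mul x y = \big[endD/end0]_(h <- s) \big[endD/end0]_(g <- t)
    einj (hmul (x h) (y g)).
Proof.
move=> us ut xs yt; rewrite /end_mul (@big_covering _ _ _ _ _ _ s) //.
- apply: eq_bigr => h _; apply: big_covering => //; first exact: undup_uniq.
    by move=> g /esupp_out->; rewrite hmul0r einj0.
  by move=> g /yt->; rewrite hmul0r einj0.
- exact: undup_uniq.
- move=> h /esupp_out->; rewrite big1 // => g _.
  by rewrite hmul0l einj0.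
- by move=> h /xs->; rewrite big1 // => g _; rewrite hmul0l einj0.
Qed.

Fact end_mulDl : left_distributive end_mul endD.
Proof.
move=> x y z; have [s [us xs ys]] := end_supp2 x y.
have [t ut zt] := end_supp z.
have xys h : h \notin s -> endD x y h = nat0 _ _.
  by move=> sh; rewrite /= xs // ys // nat0D.
rewrite !(@end_mulE _ _ s t) // -big_split /=.
apply: eq_bigr => h _; rewrite -big_split /=.
by apply: eq_bigr => g _; rewrite hmulDl einjD.
Qed.

Fact end_mulDr : right_distributive end_mul endD.
Proof.
move=> z x y; have [s [us xs ys]] := end_supp2 x y.
have [t ut zt] := end_supp z.
have xys h : h \notin s -> endD x y h = nat0 _ _.
  by move=> sh; rewrite /= xs // ys // nat0D.
rewrite !(@end_mulE _ _ t s) // -big_split /=.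
apply: eq_bigr => h _; rewrite -big_split /=.
by apply: eq_bigr => g _; rewrite hmulDr einjD.
Qed.

Let endZ_sum c (r : seq H) F : endZ c (\big[endD/end0]_(h <- r) F h)
  = \big[endD/end0]_(h <- r) endZ c (F h).
Proof. exact: (big_morph (endZ c) (endZDr c) (endZ0 c)). Qed.

Fact end_scaleAl c x y : endZ c (end_mul x y) = end_mul (endZ c x) y.
Proof.
have [s us xs] := end_supp x; have [t ut yt] := end_supp y.
have zx h : h \notin s -> endZ c x h = nat0 _ _.
  by move=> sh; rewrite /= xs // natZ0.
rewrite !(@end_mulE _ _ s t) // endZ_sum.
apply: eq_bigr => h _; rewrite endZ_sum.
by apply: eq_bigr => g _; rewrite -einjZ hmulZl.
Qed.

Fact end_scaleAr c x y : endZ c (end_mul x y) = end_mul x (endZ c y).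
Proof.
have [s us xs] := end_supp x; have [t ut yt] := end_supp y.
have zy h : h \notin t -> endZ c y h = nat0 _ _.
  by move=> th; rewrite /= yt // natZ0.
rewrite !(@end_mulE _ _ s t) // endZ_sum.
apply: eq_bigr => h _; rewrite endZ_sum.
by apply: eq_bigr => g _; rewrite -einjZ hmulZr.
Qed.

Lemma end_mul_einj h g (s : nattrans idF (Gam h)) (t : nattrans idF (Gam g)) :
  end_mul (einj s) (einj t) = einj (hmul s t).
Proof.
rewrite (@end_mulE _ _ [:: h] [:: g]) //; try exact: einj_out.
by rewrite !big_seq1 /= !einj_funE.
Qed.

Let end_mul0l x : end_mul end0 x = end0.
Proof.
have [t ut xt] := end_supp x.
by rewrite (@end_mulE _ _ [::] t) // big_nil.
Qed.
Let end_mul0r x : end_mul x end0 = end0.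
Proof.
have [t ut xt] := end_supp x.
by rewrite (@end_mulE _ _ t [::]) // big1 // => h _; rewrite big_nil.
Qed.

Fact end_mulA : associative end_mul.
Proof.
elim/end_ind => [y z|x x' IHx IHx' y z|f r]; first by rewrite !end_mul0l.
  by rewrite !end_mulDl IHx IHx'.
elim/end_ind => [z|y y' IHy IHy' z|g s].
- by rewrite end_mul0r !end_mul0l end_mul0r.
- by rewrite end_mulDr !end_mulDl end_mulDr IHy IHy'.
elim/end_ind => [|z z' IHz IHz'|h t]; first by rewrite !end_mul0r.
  by rewrite !end_mulDr IHz IHz'.
rewrite !end_mul_einj; exact/einj_existT/hmulA.
Qed.

Fact end_mul1l : left_id end_one end_mul.
Proof.
elim/end_ind => [|x y IHx IHy|h s]; first by rewrite end_mul0r.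
  by rewrite end_mulDr IHx IHy.
by rewrite end_mul_einj; exact/einj_existT/hmul1l.
Qed.

Fact end_mul1r : right_id end_one end_mul.
Proof.
elim/end_ind => [|x y IHx IHy|h s]; first by rewrite end_mul0l.
  by rewrite end_mulDl IHx IHy.
by rewrite end_mul_einj; exact/einj_existT/hmul1r.
Qed.

Definition EndAlg : kalg k :=
  @KAlg k endT end0 endD endN endZ end_one end_mul
    endDA endDC end0D endND endZA end1Z endZDr endZDl
    end_mulA end_mul1l end_mul1r end_mulDl end_mulDr end_scaleAl end_scaleAr.

End EndAction.

Section Modules.
Variables (k : fieldType) (A : fdAlg k).

Definition is_amod (V : vectType k) (rho : A -> 'End(V)) : Prop :=
  [/\ linear rho, rho 1 = \1%VF & forall a b, rho (a * b) = (rho a \o rho b)%VF].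

(* Primitive projections: the identity functor is then, by eta, of the form
   M |-> AMod _ like the twists below, which is used in the proof of Phi1. *)
#[projections(primitive)] Record amod := AMod {
  mcar : vectType k;
  rho : A -> 'End(mcar);
  amodP : is_amod rho
}.

Definition modmaps (M N : amod) : {pred 'Hom(mcar M, mcar N)} :=
  [pred f : 'Hom(mcar M, mcar N) |
    `[< forall a v, f (rho M a v) = rho N a (f v) >]].

Arguments modmaps : clear implicits.

Lemma modmapsP M N (f : 'Hom(mcar M, mcar N)) :
  reflect (forall a v, f (rho M a v) = rho N a (f v)) (f \in modmaps M N).
Proof. exact: asboolP. Qed.

Fact modmaps_submod M N : submod_closed (modmaps M N).
Proof.
split=> [|c f g /modmapsP fP /modmapsP gP]; apply/modmapsP => a v.
  by rewrite !zero_lfunE linear0.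
by rewrite !add_lfunE !scale_lfunE fP gP linearP.
Qed.
HB.instance Definition _ M N :=
  GRing.isSubmodClosed.Build k _ (modmaps M N) (modmaps_submod M N).

Record amodHom (M N : amod) := AModHom {
  hom_val :> 'Hom(mcar M, mcar N);
  hom_valP : hom_val \in modmaps M N
}.
HB.instance Definition _ M N := [isSub for @hom_val M N].
HB.instance Definition _ M N := [Choice of amodHom M N by <:].
HB.instance Definition _ M N := [SubChoice_isSubLmodule of amodHom M N by <:].

Lemma hom_val_inj M N (f g : amodHom M N) : hom_val f = hom_val g -> f = g.
Proof. exact: val_inj. Qed.

Fact amod_id_subproof M : \1%VF \in modmaps M M.
Proof. by apply/modmapsP => a v; rewrite !id_lfunE. Qed.
Definition amod_id M := AModHom (amod_id_subproof M).

Fact amod_comp_subproof M N P (g : amodHom N P) (f : amodHom M N) :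
  (g \o f)%VF \in modmaps M P.
Proof.
apply/modmapsP => a v; rewrite !comp_lfunE.
by rewrite (modmapsP _ (hom_valP f)) (modmapsP _ (hom_valP g)).
Qed.
Definition amod_comp M N P (g : amodHom N P) (f : amodHom M N) :=
  AModHom (amod_comp_subproof g f).

Fact amod_comp1m M N (f : amodHom M N) : amod_comp (amod_id N) f = f.
Proof. by apply: val_inj; exact: comp_lfun1l. Qed.
Fact amod_compm1 M N (f : amodHom M N) : amod_comp f (amod_id M) = f.
Proof. by apply: val_inj; exact: comp_lfun1r. Qed.
Fact amod_compA M N P Q (h : amodHom P Q) (g : amodHom N P) (f : amodHom M N) :
  amod_comp h (amod_comp g f) = amod_comp (amod_comp h g) f.
Proof. by apply: val_inj; exact: comp_lfunA. Qed.
Fact amod_comp_linl M N P (f : amodHom M N) :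
  linear (fun g : amodHom N P => amod_comp g f).
Proof.
move=> c g g'; apply: val_inj; apply/lfunP => v /=.
by rewrite !(comp_lfunE, add_lfunE, scale_lfunE).
Qed.
Fact amod_comp_linr M N P (g : amodHom N P) :
  linear (fun f : amodHom M N => amod_comp g f).
Proof.
move=> c f f'; apply: val_inj; apply/lfunP => v /=.
by rewrite !(comp_lfunE, add_lfunE, scale_lfunE) linearP.
Qed.

Definition Amod : klincat k :=
  @KLinCat k amod amodHom amod_id amod_comp amod_comp1m amod_compm1 amod_compA
    amod_comp_linl amod_comp_linr.

Fact twist_subproof (f : algAut A) (M : amod) : is_amod (fun a => rho M (f a)).
Proof.
have [[fl f1 fM _] [rl r1 rM]] := (autP f, amodP M); split=> [c a b||a b].
- by rewrite fl rl.
- by rewrite f1.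
- by rewrite fM rM.
Qed.
Definition twist (f : algAut A) (M : amod) : amod := AMod (twist_subproof f M).

Fact twist_hom_subproof f M N (u : amodHom M N) :
  hom_val u \in modmaps (twist f M) (twist f N).
Proof. by apply/modmapsP => a v; exact: (modmapsP _ (hom_valP u)). Qed.
Definition twist_hom f M N (u : amodHom M N) : amodHom (twist f M) (twist f N) :=
  AModHom (twist_hom_subproof f u).

Fact twist_functor f : @is_functor k Amod (twist f) (twist_hom f).
Proof.
split=> [M N c u v|M|M N P u v].
- exact: (@hom_val_inj (twist f M) (twist f N)).
- exact: (@hom_val_inj (twist f M) (twist f M)).
- exact: (@hom_val_inj (twist f M) (twist f P)).
Qed.
Definition twistF f : endofunctor Amod := Endofunctor (twist_functor f).

End Modules.

Section TwistAction.
Variables (k : fieldType) (H : groupType) (A : fdAlg k).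
Variable phi : {multiplicative H -> algAut A}.

Definition Phi (h : H) : endofunctor (Amod A) := twistF (phi h^-1%g).

Let phi1 : phi 1%g = 1%g.
Proof. by apply: (mulgI (phi 1%g)); rewrite -gmulfM !mulg1. Qed.

Let functor_eq (rep : forall M : amod A, A -> 'End(mcar M))
    (P P' : forall M, is_amod (rep M))
    (m : forall M N, amodHom M N -> amodHom (AMod (P M)) (AMod (P N)))
    (m' : forall M N, amodHom M N -> amodHom (AMod (P' M)) (AMod (P' N)))
    (f : @is_functor k (Amod A) (fun M => AMod (P M)) m)
    (f' : @is_functor k (Amod A) (fun M => AMod (P' M)) m') :
  (forall M N u, hom_val (@m M N u) = hom_val u) ->
  (forall M N u, hom_val (@m' M N u) = hom_val u) ->
  Endofunctor f = Endofunctor f'.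
Proof.
have e : P = P' by exact: Prop_irrelevance.
subst P' => mE m'E; apply: endofunctor_ext => M N u.
by apply: hom_val_inj; apply: etrans (mE M N u) (esym (m'E M N u)).
Qed.

Fact Phi1 : Phi 1%g = idF.
Proof.
have -> : Phi 1%g = twistF (aut_one A) by rewrite /Phi invg1 phi1.
exact: (@functor_eq (fun M => rho M) (twist_subproof (aut_one A)) (@amodP k A)).
Qed.

Fact PhiM h g : Phi (h * g)%g = compF (Phi h) (Phi g).
Proof.
have -> : Phi (h * g)%g = twistF (aut_mul (phi g^-1%g) (phi h^-1%g)).
  by rewrite /Phi invgM gmulfM.
exact: (@functor_eq (fun M a => rho M (phi g^-1%g (phi h^-1%g a)))
  (twist_subproof (aut_mul (phi g^-1%g) (phi h^-1%g)))
  (fun M => twist_subproof (phi h^-1%g) (twist (phi g^-1%g) M))).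
Qed.

Definition twistAction : strictAction H (Amod A) := StrictAction Phi1 PhiM.

End TwistAction.

(* Main.v *)
Require Import Defs.
From HB Require Import structures.
From mathcomp Require Import all_boot all_order all_algebra.
From mathcomp Require Import boolp.
Set Implicit Arguments.
Unset Strict Implicit.
Unset Printing Implicit Defensive.
Import GRing.Theory.
Local Open Scope ring_scope.

(* A natural transformation Id => Phi_g is determined by the image a of 1 under
   its component at the regular module, because v in M is the image of 1 under
   the module morphism b |-> b v; so its component at M is v |-> a v.
   Linearity of this component over the twisted action, read off at the regular
   module, says exactly that (a, g^-1) lies in the extended centre. *)

Lemma einj_single (k : fieldType) (H : groupType) (C : klincat k)
    (Gam : strictAction H C) (x : endT Gam) (h : H) :
  (forall g, g != h -> x g = Defs.nat0 _ _) -> x = einj (x h).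
Proof.
move=> xh; rewrite [LHS](@endE _ _ _ _ _ [:: h]) ?big_seq1 // => g.
by rewrite inE => /xh.
Qed.

(** * Homogeneous components of the extended centre *)

Section ExtendedCentreTheory.
Variables (k : fieldType) (H : groupType) (A : fdAlg k).
Variable phi : {multiplicative H -> algAut A}.

Lemma ext_centralD f a b :
  ext_central phi a f -> ext_central phi b f -> ext_central phi (a + b) f.
Proof. by move=> af bf c; rewrite mulrDl af bf mulrDr. Qed.

Lemma ext_centralZ f c a : ext_central phi a f -> ext_central phi (c *: a) f.
Proof. by move=> af b; rewrite -fd_scalerAl af fd_scalerAr. Qed.

Lemma ext_central0 f : ext_central phi 0 f.
Proof. by move=> b; rewrite mul0r mulr0. Qed.

(** For a fixed degree the admissible coefficients form a subspace, so collecting a combination of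
    generators by degree stays admissible. Conversely, finite support writes [x] as a finite sum of
    generators. *)
Lemma extZE (x : groupAlg H A) :
  x \in extZ phi <-> forall f, ext_central phi (x f) f.
Proof.
split=> [/extZP[n [c [a [f [af ->]]]]] g|xP].
  rewrite ga_sumE; apply: (big_ind (ext_central phi^~ g)) => [||i _].
  - exact: ext_central0.
  - by move=> b d; exact: ext_centralD.
  - rewrite tens_gelt -gmonZ /=; case: eqP => [->|_]; last exact: ext_central0.
    exact: ext_centralZ.
have [s us xs] := ga_supp x; rewrite (gaE us xs); apply: rpred_sum => h _.
by rewrite -tens_gelt; apply/extZP/ext_span_gen.
Qed.

Lemma ext_val_central (z : extCentre phi) f : ext_central phi (z f) f.
Proof. exact: ((extZE (ext_val z)).1 (valP z)). Qed.

(** Each homogeneous component again lies in the extended centre, so the decomposition into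
    monomials takes place inside it. *)
Lemma extCentre_ind (P : extCentre phi -> Prop) : P 0 ->
  (forall x y, P x -> P y -> P (x + y)) ->
  (forall h a x, ext_val x = gmon h a -> P x) -> forall x, P x.
Proof.
move=> P0 PD Pm x; have [s us xs] := ga_supp x.
have cen h : gmon h (ext_val x h) \in extZ phi.
  by rewrite -tens_gelt; apply/extZP/ext_span_gen/ext_val_central.
have -> : x = \sum_(h <- s) ExtCentre (cen h).
  by apply: val_inj; rewrite [LHS](gaE us xs) raddf_sum.
by apply: big_ind => // h _; exact: Pm.
Qed.

End ExtendedCentreTheory.

Section AmodLinear.
Variables (k : fieldType) (A : fdAlg k) (M : amod A).

Lemma rhoD a b : rho M (a + b) = rho M a + rho M b.
Proof. by have [rl _ _] := amodP M; have := rl 1 a b; rewrite !scale1r. Qed.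

Lemma rho0 : rho M 0 = 0.
Proof. by apply: (addIr (rho M 0)); rewrite -rhoD !add0r. Qed.

Lemma rhoZ c a : rho M (c *: a) = c *: rho M a.
Proof. by have [rl _ _] := amodP M; have := rl c a 0; rewrite rho0 !addr0. Qed.

End AmodLinear.

(** * The regular module and its morphisms to other modules *)

Section RegularModule.
Variables (k : fieldType) (A : fdAlg k).

Definition lmul (a b : A) : A := a * b.

Fact lmul_linear (a : A) : linear (lmul a).
Proof. by move=> c x y; rewrite /lmul mulrDr fd_scalerAr. Qed.
HB.instance Definition _ (a : A) :=
  GRing.isLinear.Build k A A *:%R (lmul a) (lmul_linear a).

Definition reg_rho (a : A) : 'End(fd_vect A) := linfun (lmul a).

Lemma reg_rhoE (a b : A) : reg_rho a b = a * b.
Proof. by rewrite lfunE. Qed.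

Fact reg_subproof : is_amod reg_rho.
Proof.
split=> [c a b||a b]; apply/lfunP => x.
- by rewrite add_lfunE scale_lfunE !reg_rhoE mulrDl fd_scalerAl.
- by rewrite reg_rhoE id_lfunE mul1r.
- by rewrite comp_lfunE !reg_rhoE mulrA.
Qed.
Definition regmod : amod A := AMod reg_subproof.

Section Orbit.
Variables (M : amod A) (v : mcar M).

Definition orbit (a : A) : mcar M := rho M a v.

Fact orbit_linear : linear orbit.
Proof.
have [rl _ _] := amodP M => c x y.
by rewrite /orbit rl add_lfunE scale_lfunE.
Qed.
HB.instance Definition _ :=
  GRing.isLinear.Build k A (mcar M) *:%R orbit orbit_linear.

Fact orbit_subproof :
  (linfun orbit : 'Hom(mcar regmod, mcar M)) \in @modmaps k A regmod M.
Proof.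
have [_ _ rM] := amodP M; apply/modmapsP => a b /=.
by rewrite reg_rhoE !lfunE /= /orbit rM comp_lfunE.
Qed.
Definition orbit_hom : amodHom regmod M := AModHom orbit_subproof.

Lemma orbit_homE a : hom_val orbit_hom a = rho M a v.
Proof. by rewrite lfunE. Qed.
End Orbit.

End RegularModule.

(** * Natural transformations from the identity to a twist *)

Section TwistNat.
Variables (k : fieldType) (H : groupType) (A : fdAlg k).
Variable phi : {multiplicative H -> algAut A}.

Local Notation Gam := (twistAction phi).

(* The type equation eV is usually provable by reflexivity although e is not. *)
Lemma natcast_val (F G : endofunctor (Amod A)) (e : F = G)
    (t : nattrans idF F) (M : amod A)
    (eV : 'Hom(mcar M, mcar (F M)) = 'Hom(mcar M, mcar (G M)) :> Type) :
  hom_val (natcast e t M) = ecast V V eV (hom_val (t M)).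
Proof. by case: G / e eV => eV; rewrite (Prop_irrelevance eV erefl). Qed.

Lemma hone_val (M : amod A) : hom_val (hone Gam M) = \1%VF.
Proof. exact: (@natcast_val idF (Gam 1%g) (esym (sact1 Gam)) idN M erefl). Qed.

(** Twisting changes neither carriers nor underlying linear maps, so both the whiskering by [Gam g]
    and the transport along [sactM] disappear here. *)
Lemma hmul_val h g (s : nattrans idF (Gam h)) (t : nattrans idF (Gam g))
    (M : amod A) :
  hom_val (hmul s t M) = (hom_val (s M) \o hom_val (t M))%VF.
Proof.
exact: (@natcast_val (compF (Gam g) (Gam h)) (Gam (g * h)%g)
  (esym (sactM Gam g h)) (whiskN s t) M erefl).
Qed.

Section LeftMultiplication.
Variables (g : H) (a : A).
Hypothesis ag : ext_central phi a g^-1%g.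

Fact lmul_modmaps (M : amod A) :
  rho M a \in @modmaps k A M (twist (phi g^-1%g) M).
Proof.
have [_ _ rM] := amodP M; apply/modmapsP => b v /=.
by rewrite -!comp_lfunE -!rM ag.
Qed.

Definition lmul_hom (M : amod A) : @Defs.hom k (Amod A) M (Gam g M) :=
  AModHom (lmul_modmaps M).

(** A module morphism commutes with the action of [a], and its twist is the same linear map. *)
Fact lmul_natural : @is_natural k (Amod A) idF (Gam g) lmul_hom.
Proof.
move=> M N f; apply: (@hom_val_inj _ _ M (twist (phi g^-1%g) N)).
apply/lfunP => v /=; rewrite !comp_lfunE /=.
by rewrite (modmapsP _ (hom_valP f)).
Qed.

Definition lmul_nat : nattrans idF (Gam g) := NatTrans lmul_natural.
End LeftMultiplication.

Lemma nattrans_valP g (s t : nattrans idF (Gam g)) :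
  (forall (M : amod A) (v : mcar M), hom_val (s M) v = hom_val (t M) v) -> s = t.
Proof.
move=> st; apply: nattrans_ext => M.
apply: (@hom_val_inj _ _ M (twist (phi g^-1%g) M)).
by apply/lfunP => v; exact: st.
Qed.

Definition nat_elt g (s : nattrans idF (Gam g)) : A :=
  hom_val (s (regmod A)) (1 : A).

Lemma nat_eltE g (s : nattrans idF (Gam g)) (M : amod A) (v : mcar M) :
  hom_val (s M) v = rho M (nat_elt s) v.
Proof.
have /(congr1 (fun u : amodHom (regmod A) (twist (phi g^-1%g) M) =>
  hom_val u (1 : A))) := naturalP s (orbit_hom v).
rewrite /= !comp_lfunE /= !orbit_homE.
by have [_ -> _] := amodP M; rewrite id_lfunE.
Qed.

Lemma nat_elt_central g (s : nattrans idF (Gam g)) :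
  ext_central phi (nat_elt s) g^-1%g.
Proof.
(* The component at the regular module is evaluated at [b] in two ways: twisted linearity applied to
   [b * 1] gives [phi g^-1 b * nat_elt s], and [nat_eltE] gives [nat_elt s * b]. *)
move=> b; have := modmapsP _ (hom_valP (s (regmod A))) b (1 : A).
rewrite /= !reg_rhoE mulr1 => <-.
by rewrite -[LHS]reg_rhoE; exact: (esym (nat_eltE s (b : mcar (regmod A)))).
Qed.

Lemma nat_elt_lmul g a (ag : ext_central phi a g^-1%g) :
  nat_elt (lmul_nat ag) = a.
Proof. by rewrite /nat_elt /= reg_rhoE mulr1. Qed.

(** * The two mutually inverse maps and their compatibility with the operations *)

Fact ext_to_end_fin (z : extCentre phi) :
  exists s : seq H, forall g, g \notin s ->
    lmul_nat (ext_val_central z (g^-1)%g) = Defs.nat0 _ _.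
Proof.
have [s zs] := gfin z; exists [seq h^-1%g | h <- s] => g gs.
apply: nattrans_valP => M v /=; rewrite zs ?rho0 //.
by apply: contra gs => gs; rewrite -[g]invgK map_f.
Qed.
(** Degrees are inverted because [Phi g] twists by [phi g^-1]: the coefficient at [g^-1] acts in
    degree [g]. *)
Definition ext_to_end (z : extCentre phi) : endT Gam := EndT (ext_to_end_fin z).

Fact end_to_ext_fin (x : endT Gam) :
  exists s : seq H, forall h, h \notin s -> nat_elt (x h^-1%g) = 0.
Proof.
have [s xs] := efin x; exists [seq h^-1%g | h <- s] => h hs.
rewrite xs ?/nat_elt /= ?zero_lfunE //.
by apply: contra hs => hs; rewrite -[h]invgK map_f.
Qed.

Fact end_to_ext_subproof (x : endT Gam) :
  GroupAlg (end_to_ext_fin x) \in extZ phi.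
Proof.
by apply/extZE => h b /=; rewrite nat_elt_central invgK.
Qed.
Definition end_to_ext (x : endT Gam) : extCentre phi :=
  ExtCentre (end_to_ext_subproof x).

Lemma ext_to_endK : cancel ext_to_end end_to_ext.
Proof.
move=> z; apply: val_inj; apply: groupAlgP => h /=.
by rewrite nat_elt_lmul invgK.
Qed.

Lemma end_to_extK : cancel end_to_ext ext_to_end.
Proof.
move=> x; apply: endP => g; apply: nattrans_valP => M v /=.
by rewrite nat_eltE invgK.
Qed.

Lemma ext_to_endD x y : ext_to_end (x + y) = endD (ext_to_end x) (ext_to_end y).
Proof.
by apply: endP => g; apply: nattrans_valP => M v /=; rewrite rhoD.
Qed.

Lemma ext_to_endZ c x : ext_to_end (c *: x) = endZ c (ext_to_end x).
Proof.
by apply: endP => g; apply: nattrans_valP => M v /=; rewrite rhoZ.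
Qed.

(** Allowing any [s] that acts as [a], and not just [lmul_nat], makes this apply to the unit [hone]
    and to products [hmul] as well. *)
Lemma ext_to_end_gmon g a (z : extCentre phi) (s : nattrans idF (Gam g)) :
  ext_val z = gmon g^-1%g a ->
  (forall (M : amod A) (v : mcar M), hom_val (s M) v = rho M a v) ->
  ext_to_end z = einj s.
Proof.
move=> za sa; rewrite [LHS](@einj_single _ _ _ _ _ g) => [|h hg].
  by congr einj; apply: nattrans_valP => M v; rewrite /= za gmonE sa.
apply: nattrans_valP => M v.
by rewrite /= za gmon_out ?rho0 // inE (inj_eq invg_inj).
Qed.

Lemma ext_to_end1 : ext_to_end 1 = end_one Gam.
Proof.
apply: (@ext_to_end_gmon _ 1); first by rewrite invg1.
by move=> M v; rewrite hone_val; have [_ -> _] := amodP M.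
Qed.

Lemma ext_to_endM x y :
  ext_to_end (x * y) = end_mul (ext_to_end x) (ext_to_end y).
Proof.
have E0 : ext_to_end 0 = end0 Gam.
  by apply: endP => g; apply: nattrans_valP => M v /=; rewrite rho0.
have end0M u : end_mul (end0 Gam) u = end0 Gam.
  by have [t ut tu] := end_supp u; rewrite (@end_mulE _ _ _ _ _ _ [::] t) ?big_nil.
have endM0 u : end_mul u (end0 Gam) = end0 Gam.
  have [t ut tu] := end_supp u; rewrite (@end_mulE _ _ _ _ _ _ t [::]) //.
  by rewrite big1 // => h _; rewrite big_nil.
elim/extCentre_ind: x => [|x x' IHx IHx'|g a x xa].
- by rewrite mul0r E0 end0M.
- by rewrite mulrDl !ext_to_endD IHx IHx' end_mulDl.
elim/extCentre_ind: y => [|y y' IHy IHy'|h b y yb].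
- by rewrite mulr0 E0 endM0.
- by rewrite mulrDr !ext_to_endD IHy IHy' end_mulDr.
have [xc yc] : ext_central phi a (g^-1)^-1%g /\ ext_central phi b (h^-1)^-1%g.
  have := (ext_val_central x g, ext_val_central y h).
  by rewrite xa yb !gmonE !invgK => -[].
rewrite (@ext_to_end_gmon _ a x (lmul_nat xc)) ?invgK //.
rewrite (@ext_to_end_gmon _ b y (lmul_nat yc)) ?invgK //.
(* The product of the images has degree [h^-1 * g^-1], which is the inverse of [g * h]: the reversal
   of degrees in [hmul] cancels the one caused by inversion. *)
rewrite end_mul_einj; apply: (@ext_to_end_gmon _ (a * b)).
  by rewrite -invgM invgK /= xa yb gmonM.
move=> M v; rewrite hmul_val comp_lfunE /=.
by have [_ _ ->] := amodP M; rewrite comp_lfunE.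
Qed.

Definition ext_end_iso : algIso (extCentreAlg phi) (EndAlg Gam) :=
  @AlgIso k (extCentreAlg phi) (EndAlg Gam) ext_to_end ext_to_endD ext_to_endZ
    ext_to_end1 ext_to_endM (Bijective ext_to_endK end_to_extK).

End TwistNat.

Theorem theorem11 (k : closedFieldType) (H : groupType) (A : fdAlg k)
    (phi : {multiplicative H -> algAut A}) :
  exists F : algIso (extCentreAlg phi) (EndAlg (twistAction phi)),
    forall (a : A) (h : H) (z : extCentre phi),
      ext_val z = tens a (gelt k h) ->
      exists eta : nattrans idF (twistAction phi h^-1%g),
        F z = einj eta /\
        forall (M : amod A) (v : mcar M), hom_val (eta M) v = rho M a v.
Proof.
exists (ext_end_iso phi) => a h z; rewrite tens_gelt => za.
(* Centrality of [a] is read off the coefficient of [z] at [h]; the double inverse is the form that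
   [lmul_nat] takes in degree [h^-1]. *)
have ac : ext_central phi a (h^-1)^-1%g.
  by have := ext_val_central z h; rewrite za gmonE invgK.
exists (lmul_nat ac); split=> //.
by apply: (@ext_to_end_gmon _ _ _ _ _ a); rewrite ?invgK.
Qed.
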